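(* Let $d\in\mathbb N$, let $T\subset\mathbb R^d$ be a compact interval and $\mu$ a finite Borel measure on $T$, and let $q\ge1$. Let $U^X=(U^X_t)_{t\in T}$ and $U^Y=(U^Y_t)_{t\in T}$ be copula processes on a common probability space, and let $(F_{\tilde X_t})_{t\in T}$, $(F_{\tilde Y_t})_{t\in T}$ be families of one-dimensional distribution functions with finite $q$-th moments. Define $\tilde X_t:=F_{\tilde X_t}^{[-1]}(U^X_t)$ and $\tilde Y_t:=F_{\tilde Y_t}^{[-1]}(U^Y_t)$. Assume each $F_{\tilde Y_t}$ is absolutely continuous and strictly increasing, with density $f_{\tilde Y_t}$ satisfying $\|f_{\tilde Y}\|_\infty:=\sup_{t\in T,x\in\mathbb R}|f_{\tilde Y_t}(x)|<\infty$. Then $$\|U^X-U^Y\|_{L^q(T\times\Omega)}\le\|f_{\tilde Y}\|_\infty\Big(\|\tilde X-\tilde Y\|_{L^q(T\times\Omega)}+\big\|\mathbb W_q^q(F_{\tilde X_\cdot},F_{\tilde Y_\cdot})\big\|_{L^1(T)}^{1/q}\Big),$$ and in particular $$\|U^X-U^Y\|_{L^q(T\times\Omega)}\le2\|f_{\tilde Y}\|_\infty\|\tilde X-\tilde Y\|_{L^q(T\times\Omega)}.$$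
   Context: A copula process is a process each of whose coordinates is uniformly distributed on $[0,1]$. For a distribution function $F$, $F^{[-1]}(u):=\inf\{x\in\mathbb R:F(x)\ge u\}$. $L^q(T\times\Omega)$ is taken with respect to $\mu\otimes\mathbb P$ and $L^1(T)$ with respect to $\mu$. $\mathbb W_q^q(F_{\tilde X_t},F_{\tilde Y_t})=\int_0^1|F_{\tilde X_t}^{[-1]}(u)-F_{\tilde Y_t}^{[-1]}(u)|^qdu$ is the $q$-th power of the $q$-Wasserstein distance of the one-dimensional laws. *)

(* Defs.v *)
From HB Require Import structures.
From mathcomp Require Import all_boot all_order all_algebra.
From mathcomp Require Import all_classical all_reals all_analysis.
Set Implicit Arguments. Unset Strict Implicit. Unset Printing Implicit Defensive.
Import Order.TTheory GRing.Theory Num.Theory.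
Import numFieldNormedType.Exports.
Local Open Scope classical_set_scope.
Local Open Scope ring_scope.

Definition Rd (R : realType) (d : nat) :=
  g_sigma_algebraType (@open 'rV[R]_d).

Definition cbox (R : realType) (d : nat) (a b : 'rV[R]_d) : set (Rd R d) :=
  [set x : 'rV[R]_d | forall i, a ord0 i <= x ord0 i <= b ord0 i].

Definition gen_inv (R : realType) (F : R -> R) (u : R) : R :=
  inf [set x : R | u <= F x].

Definition Wq_pow (R : realType) (q : R) (F G : R -> R) : \bar R :=
  (\int[lebesgue_measure]_(u in `[0%R, 1%R]%classic)
     (`| gen_inv F u - gen_inv G u | `^ q)%:E)%E.

(* Main.v *)
(* Put Z = F_Y^[-1](U^X), the value with the law of Y coupled to X through U^X.
   Since F_Y is Lipschitz with constant ||f_Y|| and inverts its quantile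
   function on ]0, 1[, |U^X - U^Y| <= ||f_Y|| |Z - Y|.  Minkowski's inequality
   through X gives the first bound, as E |Z - X|^q = W_q^q(F_X, F_Y).
   The second bound is the optimality of the comonotone coupling (f(V), g(V))
   among the couplings (f(U), g(V)).  With k_s(y) = q (s - y)^(q-1) 1_{y <= s}
   (dpow q s y below), |x - y|^q is the integral over s of
   1_{s < x} k_s(y) + 1_{s < y} k_s(x), so by Tonelli it is enough to minimise
   E 1_{s < f(U)} k_s(g(V)) for each s.  The event {s < f(U)} has a fixed
   probability and k_s o g is nonincreasing, so it is best to place this event
   where V is largest.  The case q = 1 is included. *)
Require Import Defs.
From HB Require Import structures.
From mathcomp Require Import all_boot all_order all_algebra.
From mathcomp Require Import all_classical all_reals all_analysis.
From mathcomp Require Import measurable_realfun ring lra.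
Import Order.TTheory GRing.Theory Num.Theory.
Import numFieldNormedType.Exports.
Local Open Scope classical_set_scope.
Local Open Scope ring_scope.

Set Implicit Arguments.
Unset Strict Implicit.
Unset Printing Implicit Defensive.

(** * Integral representation of $|x-y|^q$ *)

(** Truncation at 0 discards the negative arguments, where [powR] does not vanish; one-sided limits
    are then needed at 0 only. For [p = 0] the function is the constant 1, which serves the exponent
    [q - 1] at [q = 1]. *)
Lemma continuous_powR_max0 (R : realType) (p : R) : 0 <= p ->
  continuous (fun x : R => Num.max 0 x `^ p).
Proof.
rewrite le_eqVlt => /predU1P[<-|p0].
  by under eq_fun do rewrite powRr0; exact: cst_continuous.
move=> x; rewrite /continuous_at/=; have [x0|x0|->] := ltgtP x 0.
- apply: cvg_near_cst.
  near=> z; rewrite max_l// ltW//; near: z; exact: lt_nbhsl.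
- have : {for x, continuous (@powR R ^~ p)}.
    apply: differentiable_continuous; apply/derivable1_diffP.
    by apply: derivable_powR; rewrite in_itv/= x0.
  rewrite /prop_for/continuous_at => h.
  apply: cvg_trans h; apply: near_eq_cvg.
  near=> z; rewrite max_r// ltW//; near: z; exact: lt_nbhsr.
- suff : (fun x : R => Num.max 0 x `^ p) @ (0 : R) --> Num.max 0 0 `^ p.
    by rewrite maxxx.
  apply/(left_right_continuousP (fun x : R => Num.max 0 x `^ p)).
  rewrite maxxx powR0 ?gt_eqF//; split.
  + apply: cvg_near_cst.
    by near=> z; rewrite max_l ?powR0 ?gt_eqF.
  + apply: cvg_trans (powR_cvg0 p0); apply: near_eq_cvg.
    by near=> z; rewrite max_r.
Unshelve. all: end_near. Qed.

(** Fundamental theorem of calculus with antiderivative [h q]. Taking the positive part of [s - y]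
    makes [h q] and [h (q - 1)] continuous on the whole line, so the endpoint [y] causes no
    trouble. *)
Lemma integral_powR_shift (R : realType) (q x y : R) : 1 <= q -> y < x ->
  (\int[lebesgue_measure]_(s in `[y, x]) (q * (s - y) `^ (q - 1))%:E =
   ((x - y) `^ q)%:E)%E.
Proof.
move=> q1 yx; have q0 : 0 < q by exact: lt_le_trans q1.
pose h p (s : R) := Num.max 0 (s - y) `^ p.
have ch p : 0 <= p -> continuous (h p).
  move=> p0 s; apply: (@continuous_comp _ _ _ (fun s => s - y)
    (fun s => Num.max 0 s `^ p)); last exact: continuous_powR_max0.
  by apply: cvgB; [exact: cvg_id|exact: cvg_cst].
have hd s : y < s -> is_derive s 1 (h q) (q * h (q - 1) s).
  move=> ys; rewrite /h max_r; last by rewrite subr_ge0 ltW.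
  apply: (@near_eq_is_derive _ _ _ (fun s => (s - y) `^ q)).
    near=> z; rewrite max_r// subr_ge0 ltW//; near: z.
    exact: lt_nbhsr.
  have sy0 : 0 < s - y by rewrite subr_gt0.
  have dp := is_derive1_powR q sy0.
  have ds : is_derive s 1 (fun s => s - y) (1 - 0).
    exact: (is_deriveB (is_derive_id s 1) (is_derive_cst y s 1)).
  have := @is_derive1_comp _ (@powR R ^~ q) (fun s => s - y) s _ _ dp ds.
  by rewrite subr0 mulr1.
transitivity (\int[lebesgue_measure]_(s in `[y, x]) (q * h (q - 1) s)%:E)%E.
  apply: eq_integral => s; rewrite inE/= in_itv/= => /andP[ys _].
  by rewrite /h max_r// subr_ge0.
rewrite (@continuous_FTC2 _ (fun s => q * h (q - 1) s) (h q))//.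
- rewrite /h subrr maxxx powR0 ?gt_eqF// sube0 max_r// subr_ge0.
  exact: ltW.
- apply: continuous_subspaceT => s; apply: cvgM; first exact: cvg_cst.
  by apply: ch; rewrite subr_ge0.
- split.
  + move=> s; rewrite in_itv/= => /andP[ys _].
    by have [] := hd s ys.
  + exact/cvg_at_right_filter/ch/ltW.
  + exact/cvg_at_left_filter/ch/ltW.
- move=> s; rewrite in_itv/= => /andP[ys _].
  by rewrite derive1E; have [_ ->] := hd s ys.
Unshelve. all: end_near. Qed.

(** For [s] different from [y], the derivative in [s] of the [q]-th power of the positive part of
    [s - y]. The explicit test forces 0 where the base of [powR] is negative; at [q = 1] this is the
    indicator of [y <= s]. *)
Definition dpow (R : realType) (q s y : R) : R :=
  if y <= s then q * (s - y) `^ (q - 1) else 0.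

Lemma dpow_ge0 (R : realType) (q s y : R) : 0 <= q -> 0 <= dpow q s y.
Proof. by move=> q0; rewrite /dpow; case: ifP => // _; rewrite mulr_ge0// powR_ge0. Qed.

(** The exponent [q - 1] is nonnegative: this is how convexity of the cost enters the optimality of
    the comonotone coupling. *)
Lemma dpow_nonincreasing (R : realType) (q s y z : R) : 1 <= q -> y <= z ->
  dpow q s z <= dpow q s y.
Proof.
move=> q1 yz; have q0 : 0 <= q by exact: le_trans q1.
have [zs|sz] := leP z s; last first.
  by rewrite {1}/dpow (lt_geF sz) dpow_ge0.
rewrite /dpow zs (le_trans yz zs) ler_wpM2l// ge0_ler_powR ?nnegrE ?subr_ge0//.
  exact: le_trans zs.
exact: lerB.
Qed.

Lemma measurable_dpow (R : realType) (q : R) :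
  measurable_fun setT (fun p : R * R => dpow q p.1 p.2).
Proof.
apply: measurable_fun_if => //=.
- exact: measurable_fun_ler.
- apply: measurable_funTS; apply: measurable_funM => //.
  apply: (measurableT_comp (measurable_powR (q - 1))).
  exact: measurable_funB.
Qed.

Definition dpow_itv (R : realType) (q x y s : R) : R :=
  if s < x then dpow q s y else 0.

Lemma dpow_itv_ge0 (R : realType) (q x y s : R) : 0 <= q ->
  0 <= dpow_itv q x y s.
Proof. by move=> q0; rewrite /dpow_itv; case: ifP => // _; exact: dpow_ge0. Qed.

Lemma measurable_dpow_itv (R : realType) (q : R) d (T : measurableType d)
    (x y s : T -> R) : measurable_fun setT x -> measurable_fun setT y ->
  measurable_fun setT s ->
  measurable_fun setT (fun t => dpow_itv q (x t) (y t) (s t)).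
Proof.
move=> mx my ms; apply: measurable_fun_if => //.
- exact: measurable_fun_ltr.
- apply: measurable_funTS.
  apply: (measurableT_comp (measurable_dpow q) (g := fun t => (s t, y t))).
  exact: measurable_fun_pair.
Qed.

Lemma integral_dpow_itv (R : realType) (q x y : R) : 1 <= q ->
  (\int[lebesgue_measure]_s (dpow_itv q x y s)%:E =
   (Num.max 0 (x - y) `^ q)%:E)%E.
Proof.
move=> q1; have q0 : 0 < q by exact: lt_le_trans q1.
have [yx|xy] := ltP y x; last first.
  rewrite max_l ?subr_le0// powR0 ?gt_eqF//.
  apply: integral0_eq => s _; rewrite /dpow_itv /dpow.
  by case: ltP => // sx; rewrite (lt_geF (lt_le_trans sx xy)).
rewrite max_r; last by rewrite subr_ge0 ltW.
rewrite -integral_powR_shift// -integral_itv_bndo_bndc; last first.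
  apply/measurable_EFinP/measurable_funTS/measurable_funM => //.
  apply: (measurableT_comp (measurable_powR (q - 1))).
  exact: measurable_funB.
rewrite [RHS]integral_mkcond; apply: eq_integral => s _.
rewrite patchE /dpow_itv /dpow; have [/set_mem|/negP] := boolP (s \in _).
  by rewrite /= in_itv/= => /andP[-> ->].
case: (leP y s) => ys; case: (ltP s x) => sx // -[].
by apply/mem_set; rewrite /= in_itv/= ys.
Qed.

(** At least one of the two positive parts vanishes, and their maximum is $|x-y|$. In each integrand
    the variables separate, the indicator of [s < x] being multiplied by a function of [y], so
    couplings can be compared at each fixed [s]. *)
Lemma integral_dpow (R : realType) (q x y : R) : 1 <= q ->
  (\int[lebesgue_measure]_s (dpow_itv q x y s)%:E +
   \int[lebesgue_measure]_s (dpow_itv q y x s)%:E =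
   (`|x - y| `^ q)%:E)%E.
Proof.
move=> q1; rewrite !integral_dpow_itv// -EFinD; congr EFin.
have q0 : q != 0 by rewrite gt_eqF// (lt_le_trans _ q1).
have [yx|xy] := leP y x.
  rewrite max_r ?subr_ge0// max_l ?subr_le0// powR0// addr0.
  by rewrite ger0_norm// subr_ge0.
rewrite max_l ?subr_le0 ?ltW// max_r ?subr_ge0 ?ltW// powR0// add0r.
by rewrite distrC ger0_norm// subr_ge0 ltW.
Qed.

(** * Optimality of the comonotone coupling *)

(* K separates the values of k on the up-set S from those off S, so that
   (1_S(v) - 1_S(u)) (k v - K) <= 0 pointwise. *)
Lemma le_integral_upset_nonincreasing (R : realType) d (T : measurableType d)
    (P : {finite_measure set T -> \bar R}) (U V : T -> R) (I : set R)
    (S : R -> bool) (k : R -> R) :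
  measurable_fun setT U -> measurable_fun setT V ->
  (forall A : set R, measurable A -> P (U @^-1` A) = P (V @^-1` A)) ->
  {ae P, forall t, I (U t)} -> {ae P, forall t, I (V t)} ->
  measurable_fun setT S -> (forall u v, I u -> I v -> u <= v -> S u -> S v) ->
  measurable_fun setT k -> (forall u, 0 <= k u) ->
  (forall u v, I u -> I v -> u <= v -> k v <= k u) ->
  (\int[P]_t (if S (V t) then k (V t) else 0)%:E <=
   \int[P]_t (if S (U t) then k (V t) else 0)%:E)%E.
Proof.
move=> mU mV UV IU IV mS Sup mk k0 kanti.
have mSS : measurable [set u | S u].
  by rewrite -[X in measurable X]setTI; exact: mS.
have mSf (W : T -> R) (f : T -> R) : measurable_fun setT W ->
    measurable_fun setT f ->
    measurable_fun setT (fun t => (if S (W t) then f t else 0)%:E).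
  move=> mW mf; apply/measurable_EFinP/measurable_fun_if => //.
    exact: measurableT_comp.
  exact: measurable_funTS.
have ge0S (W : T -> R) (f : T -> R) : (forall t, 0 <= f t) ->
    forall t, setT t -> (0 <= (if S (W t) then f t else 0)%:E)%E.
  by move=> f0 t _; rewrite lee_fin; case: ifP.
have kV0 t : 0 <= k (V t) by [].
have mkV : measurable_fun setT (fun t => k (V t)) by exact: measurableT_comp.
(* If [S] holds on all of [I], the right-hand integrand is almost surely [k (V t)]. This case stands
   apart because [k] may then be unbounded on [S], leaving no finite [K]. *)
have [IS|] := pselect (forall u, I u -> S u).
  apply: ae_ge0_le_integral => //; [exact: ge0S|exact: mSf|exact: ge0S|exact: mSf|].
  by apply: filterS IU => t /IS St _; rewrite St lee_fin; case: ifP.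
move=> /existsNP[u0 Iu0Su0].
have [Iu0 Su0] : I u0 /\ ~ S u0 by apply/not_implyP.
(* The value of [k] at the point [u0] of [I] off [S] bounds this set. If [S] misses [I], the set is
   empty and [sup] defaults to 0, still a lower bound of [k]. *)
pose K := sup (k @` [set u | I u /\ S u]).
have kub : ubound (k @` [set u | I u /\ S u]) (k u0).
  move=> _ [u [Iu Su] <-]; apply: kanti => //; rewrite leNgt; apply/negP => uu0.
  by apply: Su0; apply: Sup Su => //; exact: ltW.
have KS u : I u -> S u -> k u <= K.
  by move=> Iu Su; apply: ub_le_sup; [exists (k u0)|exists u].
have KN u : I u -> ~ S u -> K <= k u.
  move=> Iu Su; have [ne|ne] := pselect (k @` [set u | I u /\ S u] !=set0).
    apply: (ge_sup ne) => _ [v [Iv Sv] <-]; apply: kanti => //; rewrite leNgt.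
    by apply/negP => uv; apply: Su; apply: Sup Sv => //; exact: ltW.
  by rewrite /K sup_out// => -[].
have K0 : 0 <= K.
  have [[_ [u ISu _]]|ne] := pselect (k @` [set u | I u /\ S u] !=set0).
    by apply: le_trans (k0 u) _; apply: ub_le_sup; [exists (k u0)|exists u].
  by rewrite /K sup_out// => -[].
have intK (W : T -> R) : measurable_fun setT W ->
    (\int[P]_t (if S (W t) then K else 0)%:E =
     K%:E * P (W @^-1` [set u | S u]))%E.
  move=> mW; have mWS : measurable (W @^-1` [set u | S u]).
    by rewrite -[X in measurable X]setTI; exact: mW.
  rewrite -integral_cst// [RHS]integral_mkcond; apply: eq_integral => t _.
  rewrite patchE; have [/set_mem SWt|/negP tS] := boolP (t \in _).
    by rewrite (SWt : S (W t)).
  by case: ifPn => // SWt; exfalso; apply: tS; exact/mem_set.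
have KU : (\int[P]_t (if S (U t) then K else 0)%:E =
           \int[P]_t (if S (V t) then K else 0)%:E)%E.
  by rewrite !intK// UV.
have Kfin : (\int[P]_t (if S (V t) then K else 0)%:E \is a fin_num)%E.
  rewrite intK// fin_numM// fin_num_measure//.
  by rewrite -[X in measurable X]setTI; exact: mV.
(* The same finite quantity is added on both sides, written with [U] on the left and with [V] on the
   right, so that the pointwise inequality is between sums of nonnegative terms and no integral is
   subtracted. *)
rewrite -(leeD2rE _ _ Kfin) -{1}KU.
have g0 (W : T -> R) (t : T) : setT t -> (0 <= (if S (W t) then k (V t) else 0)%:E)%E.
  exact: (ge0S W (fun t => k (V t)) kV0).
have K0' (W : T -> R) (t : T) : setT t -> (0 <= (if S (W t) then K else 0)%:E)%E.
  exact: (ge0S W (fun=> K) (fun=> K0)).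
have mg (W : T -> R) := (mSf W (fun t => k (V t))) ^~ mkV.
have mK (W : T -> R) := (mSf W (fun=> K)) ^~ (measurable_cst _).
rewrite -!ge0_integralD//; try by [exact: g0|exact: K0'|exact: mg|exact: mK].
apply: ae_ge0_le_integral => //.
- by move=> t tT; apply: adde_ge0; [exact: g0|exact: K0'].
- by apply: emeasurable_funD; [exact: mg|exact: mK].
- by move=> t tT; apply: adde_ge0; [exact: g0|exact: K0'].
- by apply: emeasurable_funD; [exact: mg|exact: mK].
apply: filterS2 IU IV => t IUt IVt _.
rewrite -!EFinD lee_fin.
have [SV|/negP SV] := boolP (S (V t)); have [SU|/negP SU] := boolP (S (U t));
  rewrite ?addr0 ?add0r//; [exact: KS|exact: KN].
Qed.

Lemma eq_law_ge0_integral (R : realType) d (T : measurableType d)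
    (P : {measure set T -> \bar R}) (U V : T -> R) (h : R -> \bar R) :
  measurable_fun setT U -> measurable_fun setT V ->
  (forall A : set R, measurable A -> P (U @^-1` A) = P (V @^-1` A)) ->
  measurable_fun setT h -> (forall u, 0 <= h u)%E ->
  (\int[P]_t h (U t) = \int[P]_t h (V t))%E.
Proof.
move=> mU mV UV mh h0.
transitivity (\int[pushforward P U]_u h u)%E.
  by rewrite (ge0_integral_pushforward mU P measurableT)// preimage_setT.
transitivity (\int[pushforward P V]_u h u)%E; last first.
  by rewrite (ge0_integral_pushforward mV P measurableT)// preimage_setT.
by apply: eq_measure_integral => A mA _; exact: UV.
Qed.

(** The cost is split into two halves, and the comparison on up-sets is applied to each at every
    level [s]. Monotonicity is asked on [I] only, because quantile functions can take default values
    at 0 and 1. *)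
Lemma le_integral_comonotone (R : realType) d (T : measurableType d)
    (P : {finite_measure set T -> \bar R}) (q : R) (U V : T -> R) (I : set R)
    (f g : R -> R) : 1 <= q ->
  measurable_fun setT U -> measurable_fun setT V ->
  (forall A : set R, measurable A -> P (U @^-1` A) = P (V @^-1` A)) ->
  {ae P, forall t, I (U t)} -> {ae P, forall t, I (V t)} ->
  measurable_fun setT f -> measurable_fun setT g ->
  (forall u v, I u -> I v -> u <= v -> f u <= f v) ->
  (forall u v, I u -> I v -> u <= v -> g u <= g v) ->
  (\int[P]_t (`|f (V t) - g (V t)| `^ q)%:E <=
   \int[P]_t (`|f (U t) - g (V t)| `^ q)%:E)%E.
Proof.
move=> q1 mU mV UV IU IV mf mg fmono gmono.
have q0 : 0 <= q by exact: le_trans q1.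
have mA (x y : T -> R) : measurable_fun setT x -> measurable_fun setT y ->
    measurable_fun setT (fun p : T * R => (dpow_itv q (x p.1) (y p.1) p.2)%:E).
  move=> mx my; apply/measurable_EFinP/measurable_dpow_itv => //.
    exact: measurableT_comp.
  exact: measurableT_comp.
have A0 (x y : T -> R) (p : T * R) :
    (0 <= (dpow_itv q (x p.1) (y p.1) p.2)%:E)%E.
  by rewrite lee_fin dpow_itv_ge0.
(* By Tonelli, [J x y] is the expectation of the [q]-th power of the positive part of [x - y], with
   the level [s] integrated last. *)
pose J (x y : T -> R) :=
  (\int[lebesgue_measure]_s \int[P]_t (dpow_itv q (x t) (y t) s)%:E)%E.
have JE (x y : T -> R) : measurable_fun setT x -> measurable_fun setT y ->
    (\int[P]_t (`|x t - y t| `^ q)%:E = J x y + J y x)%E.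
  move=> mx my.
  under eq_integral do rewrite -integral_dpow//.
  rewrite ge0_integralD//.
  - congr (_ + _)%E.
      exact: (@fubini_tonelli _ _ _ _ _ P lebesgue_measure _ (mA x y mx my) (A0 x y)).
    exact: (@fubini_tonelli _ _ _ _ _ P lebesgue_measure _
      (mA y x my mx) (A0 y x)).
  - by move=> t _; apply: integral_ge0 => s _; exact: (A0 x y (t, s)).
  - exact: (@measurable_fun_fubini_tonelli_F _ _ _ _ _ lebesgue_measure _
      (mA x y mx my) (A0 x y)).
  - by move=> t _; apply: integral_ge0 => s _; exact: (A0 y x (t, s)).
  - exact: (@measurable_fun_fubini_tonelli_F _ _ _ _ _ lebesgue_measure _
      (mA y x my mx) (A0 y x)).
have mJ (x y : T -> R) : measurable_fun setT x -> measurable_fun setT y ->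
    measurable_fun setT (fun s => \int[P]_t (dpow_itv q (x t) (y t) s)%:E)%E.
  move=> mx my.
  exact: (@measurable_fun_fubini_tonelli_G _ _ _ _ _ P _ (mA x y mx my) (A0 x y)).
have leJ (x y x' y' : T -> R) : measurable_fun setT x -> measurable_fun setT y ->
    measurable_fun setT x' -> measurable_fun setT y' ->
    (forall s, \int[P]_t (dpow_itv q (x t) (y t) s)%:E <=
               \int[P]_t (dpow_itv q (x' t) (y' t) s)%:E)%E ->
    (J x y <= J x' y')%E.
  move=> mx my mx' my' le; apply: ge0_le_integral => //.
  - by move=> s _; apply: integral_ge0 => t _; exact: (A0 x y (t, s)).
  - exact: mJ.
  - exact: mJ.
have key (a b : R -> R) (W1 W2 : T -> R) :
    measurable_fun setT W1 -> measurable_fun setT W2 ->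
    (forall A : set R, measurable A -> P (W1 @^-1` A) = P (W2 @^-1` A)) ->
    {ae P, forall t, I (W1 t)} -> {ae P, forall t, I (W2 t)} ->
    measurable_fun setT a -> measurable_fun setT b ->
    (forall u v, I u -> I v -> u <= v -> a u <= a v) ->
    (forall u v, I u -> I v -> u <= v -> b u <= b v) ->
    (J (a \o W2) (b \o W2) <= J (a \o W1) (b \o W2))%E.
  move=> mW1 mW2 W12 IW1 IW2 ma mb amono bmono.
  apply: leJ; try exact: measurableT_comp.
  move=> s; apply: (@le_integral_upset_nonincreasing _ _ _ P W1 W2 I
    (fun u => s < a u) (fun u => dpow q s (b u))) => //.
  - exact: measurable_fun_ltr.
  - by move=> u v Iu Iv uv su; apply: lt_le_trans su _; exact: amono.
  - apply: (measurableT_comp (measurable_dpow q) (g := fun u => (s, b u))).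
    exact: measurable_fun_pair.
  - by move=> u; exact: dpow_ge0.
  - by move=> u v Iu Iv uv; apply: dpow_nonincreasing => //; exact: bmono.
rewrite (JE (f \o V) (g \o V)); [|exact: measurableT_comp..].
rewrite (JE (f \o U) (g \o V)); [|exact: measurableT_comp..].
apply: leeD; first exact: key.
(* In the second half [g] defines the up-set and [f] the weight, so [key] is used with [U] and [V]
   exchanged. It produces the comonotone pair driven by [U], which has the same law as the one
   driven by [V]. *)
have -> : J (g \o V) (f \o V) = J (g \o U) (f \o U).
  apply: eq_integral => s _.
  apply: (@eq_law_ge0_integral _ _ _ P V U
    (fun u => (dpow_itv q (g u) (f u) s)%:E)) => //.
  - by move=> A mA'; apply/esym/UV.
  - by apply/measurable_EFinP/measurable_dpow_itv.
  - by move=> u; rewrite lee_fin dpow_itv_ge0.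
by apply: key => // A mA'; apply/esym/UV.
Qed.

(** * Generalized inverses of distribution functions *)

Section gen_inv.
Variables (R : realType) (F : cumulativeBounded (0 : R) 1).
Implicit Types u x : R.

Lemma cumulativeBounded_le x y : x <= y -> F x <= F y.
Proof. exact: cumulative_is_nondecreasing. Qed.

Lemma cumulativeBounded_ge0 x : 0 <= F x.
Proof.
rewrite leNgt; apply/negP => Fx0.
have [M [_ MF]] := cvgr_gt _ (cumulativeNy F) _ Fx0.
have := MF (Num.min (M - 1) x); rewrite gt_min ltrBlDr ltrDl ltr01 => /(_ isT).
by apply/negP; rewrite -leNgt cumulativeBounded_le// ge_min lexx orbT.
Qed.

(** Every real [x] satisfies [u <= F x], so the set is unbounded below and [inf] takes its default
    value 0. *)
Lemma gen_inv_le0 u : u <= 0 -> gen_inv F u = 0.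
Proof.
move=> u0; apply: inf_out => -[_ [m lm]].
have := lm (m - 1) (le_trans u0 (cumulativeBounded_ge0 _)).
by rewrite lerBrDr gerDl ler10.
Qed.

(* If F never reaches u, gen_inv F u is the infimum of the empty set, that is 0:
   hence the second disjunct. *)
Lemma gen_invP u x : 0 < u ->
  gen_inv F u <= x <->
  u <= F x \/ ((forall n : nat, F n%:R < u) /\ 0 <= x).
Proof.
move=> u0; have [E0|E0] := pselect ([set x | u <= F x] !=set0); last first.
  have -> : gen_inv F u = 0 by apply: inf_out => -[].
  have Fu y : F y < u by rewrite ltNge; apply/negP => uF; apply: E0; exists y.
  by split=> [|[|[]//]]; [right|rewrite leNgt Fu].
have infE : has_inf [set x | u <= F x].
  split=> //; have [M [_ MF]] := cvgr_lt _ (cumulativeNy F) _ u0.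
  exists (M - 1) => y /= uy; rewrite leNgt; apply/negP => yM.
  have := MF (M - 1); rewrite ltrBlDr ltrDl ltr01 => /(_ isT); apply/negP.
  rewrite -leNgt (le_trans uy)// cumulativeBounded_le//.
  exact: ltW.
(* Right continuity makes the infimum a minimum: otherwise [F] would stay below [u] on a right
   neighbourhood, which must contain points of the set. *)
have uz : u <= F (gen_inv F u).
  rewrite leNgt; apply/negP => Fzu.
  have e0 : 0 < (u - F (gen_inv F u)) / 2 by rewrite divr_gt0// subr_gt0.
  have [d Fd] : exists d : {posnum R}, F (gen_inv F u + d%:num) <=
      F (gen_inv F u) + (u - F (gen_inv F u)) / 2.
    exact: (nondecreasing_right_continuousP (gen_inv F u) F e0).
  have [y /= uy yd] := inf_adherent (gt0 d) infE.
  have := le_trans uy (cumulativeBounded_le (ltW yd)).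
  move=> /le_trans /(_ Fd); lra.
split=> [zx|[uF|[Fn x0]]].
- by left; apply: le_trans uz _; exact: cumulativeBounded_le.
- by apply: ge_inf => //; case: infE.
- have [y /= uy] := E0; exfalso.
  have := Fn (Num.bound `|y|); apply/negP; rewrite -leNgt (le_trans uy)//.
  rewrite cumulativeBounded_le// (le_trans (ler_norm _))// ltW//.
  exact: archi_boundP (normr_ge0 _).
Qed.

(** Galois connection between [F] and its quantile function: since [F] tends to 1, which exceeds
    [u], the level [u] is reached and the default case is excluded. *)
Lemma gen_inv_leP u x : 0 < u < 1 -> (gen_inv F u <= x) = (u <= F x).
Proof.
move=> /andP[u0 u1]; apply/idP/idP => [/(gen_invP _ u0)[//|[Fn _]]|uF].
  have [M [_ MF]] := cvgr_gt _ (cumulativey F) _ u1.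
  have Mb : M < (Num.bound `|M|)%:R.
    exact: le_lt_trans (ler_norm _) (archi_boundP (normr_ge0 _)).
  by have := MF _ Mb; rewrite ltNge ltW.
by apply/gen_invP => //; left.
Qed.

Lemma gen_inv_nondecreasing u v : 0 < u < 1 -> 0 < v < 1 -> u <= v ->
  gen_inv F u <= gen_inv F v.
Proof.
by move=> u01 v01 uv; rewrite gen_inv_leP// (le_trans uv)// -gen_inv_leP.
Qed.

(** A Lipschitz [F] has no jump to skip the level [u]: if [F] exceeded [u] at the quantile, it would
    still do so slightly to the left. *)
Lemma gen_invK (M : R) u : 0 <= M ->
  (forall x y, x <= y -> F y - F x <= M * (y - x)) ->
  0 < u < 1 -> F (gen_inv F u) = u.
Proof.
move=> M0 lipF u01; apply/eqP; rewrite eq_le -gen_inv_leP// lexx andbT.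
rewrite leNgt; apply/negP => uF; set z := gen_inv F u in uF.
(* Chosen so that [M * e] equals [F z - u - e]; the Lipschitz bound then leaves [F (z - e)] at least
   [u + e]. The denominator [M + 1] also covers [M = 0]. *)
pose e := (F z - u) / (M + 1).
have e0 : 0 < e by rewrite divr_gt0// ?subr_gt0// ltr_wpDl.
have : F (z - e) < u by rewrite ltNge -gen_inv_leP// -/z -ltNge ltrBlDr ltrDl.
have := lipF (z - e) z; rewrite lerBlDr lerDl ltW// => /(_ isT).
have -> : M * (z - (z - e)) = F z - u - e.
  by rewrite /e; field; rewrite gt_eqF// ltr_wpDl.
lra.
Qed.

End gen_inv.

(** Sublevel sets are described by [gen_invP], with the value 0 where [U t <= 0]. That [F t] never
    reaches [U t] is tested at the natural numbers only, enough by monotonicity and countable as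
    measurability requires. *)
Lemma measurable_gen_inv (R : realType) d (T : measurableType d)
    (F : T -> cumulativeBounded (0 : R) 1) (U : T -> R) :
  (forall x, measurable_fun setT (fun t => F t x)) -> measurable_fun setT U ->
  measurable_fun setT (fun t => gen_inv (F t) (U t)).
Proof.
move=> mF mU.
have mle (f g : T -> R) : measurable_fun setT f -> measurable_fun setT g ->
    measurable [set t | f t <= g t].
  by move=> mf mg; rewrite -[X in measurable X]setTI; exact: measurable_fun_le.
have mlt (f g : T -> R) : measurable_fun setT f -> measurable_fun setT g ->
    measurable [set t | f t < g t].
  move=> mf mg; rewrite (_ : [set _ | _] = ~` [set t | g t <= f t]).
    by apply: measurableC; exact: mle.
  by apply/seteqP; split=> t /=; rewrite ltNge => /negP.
apply: (measurability _ (RGenOInfty.measurableE R)) => //.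
move=> _ [_ [x ->] <-]; rewrite setTI.
rewrite (_ : _ @^-1` _ =
  ~` (([set t | U t <= 0] `&` [set t | 0 <= x]) `|`
      ([set t | 0 < U t] `&`
       ([set t | U t <= F t x] `|`
        (\bigcap_(n in @setT nat) [set t | F t n%:R < U t] `&`
         [set t | 0 <= x]))))).
  apply: measurableC; apply: measurableU; first by apply: measurableI; exact: mle.
  apply: measurableI; first exact: mlt.
  apply: measurableU; first exact: mle.
  apply: measurableI; last exact: mle.
  by apply: bigcapT_measurable => n; exact: mlt.
rewrite -[LHS]setCK; congr (~` _); apply/seteqP; split => t /=.
  rewrite in_itv/= andbT => /negP; rewrite -leNgt => gx.
  have [U0|U0] := leP (U t) 0; first by left; rewrite -(gen_inv_le0 (F t) U0).
  right; split => //; have [//|UF|[UF x0]] := (gen_invP (F t) x U0).1.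
    by left.
  by right; split=> [n _|]; [exact: UF|].
rewrite in_itv/= andbT => h; apply/negP; rewrite -leNgt.
case: h => [[U0 x0]|[U0 h]]; first by rewrite gen_inv_le0.
apply/gen_invP => //; case: h => [|[UF x0]]; first by left.
by right; split => // n; exact: UF.
Qed.

(** * Measurability of the box and uniform marginals *)

Lemma measurable_cbox (R : realType) (d : nat) (a b : 'rV[R]_d) :
  measurable (cbox a b).
Proof.
rewrite -[cbox a b]setCK; apply: measurableC.
apply: (@sub_sigma_algebra _ setT (@open 'rV[R]_d)).
rewrite openC (_ : cbox a b = \bigcap_(i in @setT 'I_d)
  ((fun x : 'rV[R]_d => x ord0 i) @^-1` `[a ord0 i, b ord0 i])).
  apply: closed_bigI => i _; apply: preimage_closed.
    by move=> x _; exact: coord_continuous.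
  exact: itv_closed.
apply/seteqP; split=> x /= h i; have := h i; rewrite ?in_itv//.
by move=> /(_ Logic.I); rewrite /= in_itv.
Qed.

Section uniform.
Variables (R : realType) (d : measure_display) (T : measurableType d).
Variables (P : probability T R) (U : T -> R).
Hypothesis mU : measurable_fun setT U.
Hypothesis unifU : forall A : set R, measurable A ->
  P (U @^-1` A) = uniform_prob (@ltr01 R) A.

Lemma integral_uniform_law (h : R -> \bar R) : measurable_fun setT h ->
  (forall u, 0 <= h u)%E ->
  (\int[P]_t h (U t) = \int[lebesgue_measure]_(u in `[0%R, 1%R]) h u)%E.
Proof.
move=> mh h0; pose U' : T -> measurableTypeR R := U.
have mU' : measurable_fun setT U' by exact: mU.
have mh' : @measurable_fun _ _ (measurableTypeR R) _ setT h by exact: mh.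
transitivity (\int[pushforward P U']_u h u)%E.
  by rewrite (ge0_integral_pushforward mU' P measurableT)// preimage_setT.
transitivity (\int[uniform_prob (@ltr01 R)]_u h u)%E.
  by apply: eq_measure_integral => A mA _; exact: unifU.
by rewrite integral_uniform// subr0 invr1 mul1e.
Qed.

(** The endpoints carry no mass. This confines the argument to the open interval, where the quantile
    identities hold. *)
Lemma ae_uniform_oo : {ae P, forall t, 0 < U t < 1}.
Proof.
have mI : measurable (U @^-1` `]0, 1[%classic).
  by rewrite -[X in measurable X]setTI; exact: mU.
have PI : P (U @^-1` `]0, 1[%classic) = 1%E.
  rewrite unifU// -(@integral_uniform_pdf1 R 0 1 `[0, 1]%classic (@ltr01 R))//.
  rewrite /uniform_prob [RHS]integral_itv_bndoo//.
  apply/measurable_EFinP; apply: measurable_funTS; exact: measurable_uniform_pdf.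
exists (~` (U @^-1` `]0, 1[%classic)); split.
- exact: measurableC.
- by rewrite probability_setC// PI subee.
- by apply: subsetC => t /=; rewrite in_itv.
Qed.

End uniform.

(** * Lipschitz bound from the density, norms and sections *)

Lemma density_lipschitz (R : realType) (F f : R -> R) (M : R) :
  measurable_fun setT f -> (forall x, 0 <= f x) -> (forall x, f x <= M) ->
  (forall x, (F x)%:E = \int[lebesgue_measure]_(y in `]-oo, x]) (f y)%:E)%E ->
  forall x y, x <= y -> F y - F x <= M * (y - x).
Proof.
move=> mf f0 fM Ff x y xy.
have h : ((F y)%:E = (F x)%:E +
    \int[lebesgue_measure]_(z in `]x, y]) (f z)%:E)%E.
  rewrite !Ff -ge0_integral_setU//.
  - congr integral; apply/seteqP; split=> z /=; rewrite !in_itv/=.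
      by move=> zy; case: leP => xz; [left|right].
    by case=> [zx|/andP[]//]; exact: le_trans xy.
  - exact/measurable_EFinP/measurable_funTS.
  - by move=> z _; rewrite lee_fin.
  - apply/disj_set2P/seteqP; split=> z // [] /=; rewrite !in_itv/= => zx /andP[xz _].
    by move: xz; rewrite ltNge zx.
have : (\int[lebesgue_measure]_(z in `]x, y]) (f z)%:E <= (M * (y - x))%:E)%E.
  apply: (@le_trans _ _ (\int[lebesgue_measure]_(z in `]x, y]) (cst M%:E z))%E).
    apply: ge0_le_integral => //.
    - by move=> z _; rewrite lee_fin.
    - exact/measurable_EFinP/measurable_funTS.
    - by move=> z _; rewrite lee_fin.
  rewrite integral_cst//= lebesgue_measure_itv/= lte_fin.
  case: ltP => [_|yx]; first by rewrite -EFinD -EFinM.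
  by rewrite mule0 lee_fin mulr_ge0 ?subr_ge0// (le_trans (f0 0)).
by rewrite lerBlDl -lee_fin EFinD h => /(leeD2l (F x)%:E).
Qed.

Lemma Lnorm_EFin_powR (R : realType) d (T : measurableType d)
    (mu : {measure set T -> \bar R}) (q : R) (f : T -> R) :
  Lnorm mu q%:E (fun t => (f t)%:E) =
  ((\int[mu]_t (`|f t| `^ q)%:E) `^ q^-1)%E.
Proof. by rewrite unlock. Qed.

Lemma le_poweR_inv (R : realType) (q : R) (x y : \bar R) : 0 < q ->
  (0 <= x)%E -> (x <= y)%E -> (x `^ q^-1 <= y `^ q^-1)%E.
Proof.
move=> q0 x0 xy; apply: gt0_ler_poweR => //.
- by rewrite invr_ge0 ltW.
- by rewrite in_itv/= x0 leey.
- by rewrite in_itv/= (le_trans x0 xy) leey.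
Qed.

Lemma le_Lnorm_EFin (R : realType) d (T : measurableType d)
    (mu : {measure set T -> \bar R}) (q : R) (f g : T -> R) : 0 < q ->
  (\int[mu]_t (`|f t| `^ q)%:E <= \int[mu]_t (`|g t| `^ q)%:E)%E ->
  (Lnorm mu q%:E (fun t => (f t)%:E) <= Lnorm mu q%:E (fun t => (g t)%:E))%E.
Proof.
move=> q0 fg; rewrite !Lnorm_EFin_powR; apply: le_poweR_inv => //.
by apply: integral_ge0 => t _; rewrite lee_fin powR_ge0.
Qed.

Lemma Lnorm_EFin_Z (R : realType) d (T : measurableType d)
    (mu : {measure set T -> \bar R}) (q M : R) (f : T -> R) : 0 < q -> 0 <= M ->
  measurable_fun setT f ->
  (Lnorm mu q%:E (fun t => (M * f t)%:E) =
   M%:E * Lnorm mu q%:E (fun t => (f t)%:E))%E.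
Proof.
move=> q0 M0 mf; rewrite !Lnorm_EFin_powR.
under eq_integral do rewrite normrM powRM// EFinM.
rewrite ge0_integralZl//; last first.
  apply/measurable_EFinP; apply: (measurableT_comp (measurable_powR q)).
  exact: measurableT_comp.
rewrite poweRM//; last by apply: integral_ge0 => t _; rewrite lee_fin powR_ge0.
by rewrite poweR_EFin -powRrM mulfV ?gt_eqF// powRr1// ger0_norm.
Qed.

(** Tonelli integrates over [Omega] first, so the exceptional null set may depend on [t] and no
    exceptional set in the product has to be built. *)
Lemma le_integral_ae_section (R : realType) d1 d2 (T : measurableType d1)
    (Omega : measurableType d2)
    (mu : {sigma_finite_measure set T -> \bar R})
    (P : {sigma_finite_measure set Omega -> \bar R})
    (D : set T) (f g : T * Omega -> \bar R) :
  measurable D -> mu (~` D) = 0%E ->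
  measurable_fun setT f -> measurable_fun setT g ->
  (forall p, 0 <= f p)%E -> (forall p, 0 <= g p)%E ->
  (forall t, D t -> {ae P, forall w, (f (t, w) <= g (t, w))%E}) ->
  (\int[mu \x P]_p f p <= \int[mu \x P]_p g p)%E.
Proof.
move=> mD D0 mf mg f0 g0 fg.
rewrite !fubini_tonelli1//; apply: ae_ge0_le_integral => //.
- by move=> t _; apply: integral_ge0.
- exact: measurable_fun_fubini_tonelli_F.
- by move=> t _; apply: integral_ge0.
- exact: measurable_fun_fubini_tonelli_F.
exists (~` D); split => //; first exact: measurableC.
apply: subsetC => t Dt _ /=; apply: ae_ge0_le_integral => //.
- by apply: measurableT_comp mf _; exact: pair1_measurable.
- by apply: measurableT_comp mg _; exact: pair1_measurable.
by apply: filterS (fg t Dt).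
Qed.

(** * The Wasserstein distance as an optimal coupling cost *)

Lemma measurable_quantile (R : realType) (F : cumulativeBounded (0 : R) 1) :
  measurable_fun setT (gen_inv F).
Proof.
by have := @measurable_gen_inv R _ _ (fun=> F) (@idfun R)
  (fun=> measurable_cst _) (@measurable_id _ _ _).
Qed.

Section Wq_pow_coupling.
Variables (R : realType) (q : R) (d : measure_display) (T : measurableType d).
Variables (P : probability T R) (F G : cumulativeBounded (0 : R) 1).

Let measurable_dist : measurable_fun setT
  (fun u => (`|gen_inv F u - gen_inv G u| `^ q)%:E).
Proof.
apply/measurable_EFinP; apply: (measurableT_comp (measurable_powR q)).
by apply: measurableT_comp => //; apply: measurable_funB; exact: measurable_quantile.
Qed.

(** Driving both quantile functions by one uniform variable realises the distance; any such variable
    will do. *)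
Lemma Wq_powE (U : T -> R) : measurable_fun setT U ->
  (forall A : set R, measurable A ->
    P (U @^-1` A) = uniform_prob (@ltr01 R) A) ->
  Wq_pow q F G =
  (\int[P]_t (`|gen_inv F (U t) - gen_inv G (U t)| `^ q)%:E)%E.
Proof.
move=> mU unifU; rewrite (@integral_uniform_law _ _ _ _ _ mU unifU
  (fun u => (`|gen_inv F u - gen_inv G u| `^ q)%:E))//.
Qed.

Lemma Wq_pow_le_coupling (U V : T -> R) : 1 <= q ->
  measurable_fun setT U -> measurable_fun setT V ->
  (forall A : set R, measurable A ->
    P (U @^-1` A) = uniform_prob (@ltr01 R) A) ->
  (forall A : set R, measurable A ->
    P (V @^-1` A) = uniform_prob (@ltr01 R) A) ->
  (Wq_pow q F G <=
   \int[P]_t (`|gen_inv F (U t) - gen_inv G (V t)| `^ q)%:E)%E.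
Proof.
move=> q1 mU mV unifU unifV; rewrite (Wq_powE mV unifV).
apply: (@le_integral_comonotone _ _ _ P q U V [set u | 0 < u < 1]
  (gen_inv F) (gen_inv G)) => //.
- by move=> A mA; exact: etrans (unifU A mA) (esym (unifV A mA)).
- exact: ae_uniform_oo.
- exact: ae_uniform_oo.
- exact: measurable_quantile.
- exact: measurable_quantile.
- exact: gen_inv_nondecreasing.
- exact: gen_inv_nondecreasing.
Qed.

End Wq_pow_coupling.

Lemma measurable_Wq_pow (R : realType) (q : R) d (T : measurableType d)
    (F G : T -> cumulativeBounded (0 : R) 1) :
  (forall x, measurable_fun setT (fun t => F t x)) ->
  (forall x, measurable_fun setT (fun t => G t x)) ->
  measurable_fun setT (fun t => Wq_pow q (F t) (G t)).
Proof.
move=> mF mG.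
have mH (H : T -> cumulativeBounded (0 : R) 1) :
    (forall x, measurable_fun setT (fun t => H t x)) ->
    measurable_fun setT (fun p : T * R => gen_inv (H p.1) p.2).
  move=> mH; apply: (@measurable_gen_inv _ _ (T * R)%type (H \o fst) snd) => //.
  by move=> x; apply: (measurableT_comp (mH x)).
have m : measurable_fun setT (fun p : T * measurableTypeR R =>
    (`|gen_inv (F p.1) p.2 - gen_inv (G p.1) p.2| `^ q)%:E).
  apply/measurable_EFinP; apply: (measurableT_comp (measurable_powR q)).
  by apply: measurableT_comp => //; apply: measurable_funB; exact: mH.
have n0 (p : T * measurableTypeR R) :
    (0 <= (`|gen_inv (F p.1) p.2 - gen_inv (G p.1) p.2| `^ q)%:E)%E.
  by rewrite lee_fin powR_ge0.
(* Reading the integral over the unit interval as one against the uniform probability turns it into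
   a section integral covered by Tonelli. *)
have := @measurable_fun_fubini_tonelli_F _ _ _ _ _ (uniform_prob (@ltr01 R)) _ m n0.
congr (measurable_fun _ _); apply/funext => t.
rewrite /fubini_F integral_uniform//.
  by rewrite subr0 invr1 mul1e.
by apply: measurableT_comp m _; exact: pair1_measurable.
Qed.

(** * The two bounds for copula processes *)

Unset Implicit Arguments.
Set Strict Implicit.

Theorem theorem4p14 (R : realType) (d : nat) (a b : 'rV[R]_d)
  (ab : forall i, a ord0 i <= b ord0 i)
  (mu : {finite_measure set (Rd R d) -> \bar R})
  (mu_supp : mu (~` cbox a b) = 0%E)
  (q : R) (q1 : 1 <= q)
  (dO : measure_display) (Omega : measurableType dO) (P : probability Omega R)
  (UX UY : Rd R d -> Omega -> R)
  (UX_meas : measurable_fun setT (fun p : Rd R d * Omega => UX p.1 p.2))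
  (UY_meas : measurable_fun setT (fun p : Rd R d * Omega => UY p.1 p.2))
  (UX_unif : forall t, cbox a b t -> forall A : set R, measurable A ->
      P (UX t @^-1` A) = uniform_prob (@ltr01 R) A)
  (UY_unif : forall t, cbox a b t -> forall A : set R, measurable A ->
      P (UY t @^-1` A) = uniform_prob (@ltr01 R) A)
  (FX FY : Rd R d -> cumulativeBounded (0 : R) 1)
  (FX_meas : forall x : R, measurable_fun setT (fun t => FX t x))
  (FY_meas : forall x : R, measurable_fun setT (fun t => FY t x))
  (FX_mom : forall t, cbox a b t ->
      (\int[lebesgue_stieltjes_measure (FX t)]_x (`|x| `^ q)%:E < +oo)%E)
  (FY_mom : forall t, cbox a b t ->
      (\int[lebesgue_stieltjes_measure (FY t)]_x (`|x| `^ q)%:E < +oo)%E)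
  (fY : Rd R d -> R -> R)
  (fY_meas : forall t, cbox a b t -> measurable_fun setT (fY t))
  (fY_ge0 : forall t, cbox a b t -> forall x, 0 <= fY t x)
  (FY_dens : forall t, cbox a b t -> forall x,
      ((FY t x)%:E = \int[lebesgue_measure]_(y in `]-oo, x]) (fY t y)%:E)%E)
  (FY_incr : forall t, cbox a b t -> {homo FY t : x y / x < y})
  (fY_bnd : (ereal_sup [set (`|fY p.1 p.2|)%:E | p in cbox a b `*` [set: R]]
               < +oo)%E) :
  let fYsup := ereal_sup [set (`|fY p.1 p.2|)%:E | p in cbox a b `*` [set: R]] in
  let Xt := fun p : Rd R d * Omega => gen_inv (FX p.1) (UX p.1 p.2) in
  let Yt := fun p : Rd R d * Omega => gen_inv (FY p.1) (UY p.1 p.2) in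
  let normU := Lnorm (mu \x P)%E q%:E (fun p => (UX p.1 p.2 - UY p.1 p.2)%:E) in
  let normXY := Lnorm (mu \x P)%E q%:E (fun p => (Xt p - Yt p)%:E) in
  let W := Lnorm mu 1%E (fun t => Wq_pow q (FX t) (FY t)) in
  (normU <= fYsup * (normXY + W `^ q^-1))%E /\
  (normU <= 2%:E * fYsup * normXY)%E.
Proof.
move=> fYsup Xt Yt normU normXY W.
have q0 : 0 < q by exact: lt_le_trans q1.
have mbox := measurable_cbox a b.
(* A point of the box makes the supremum nonnegative; being below [+oo], it is then a real number
   [M]. *)
have boxa : cbox a b a by move=> i; rewrite lexx ab.
have fY_le t x : cbox a b t -> ((`|fY t x|)%:E <= fYsup)%E.
  by move=> tab; apply: ereal_sup_ubound; exists (t, x).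
have fYsup0 : (0 <= fYsup)%E by apply: le_trans (fY_le a 0 boxa); rewrite lee_fin.
pose M := fine fYsup.
have fYsupE : fYsup = M%:E by rewrite fineK// ge0_fin_numE.
have M0 : 0 <= M by rewrite fine_ge0.
have lipFY t : cbox a b t -> forall x y, x <= y -> FY t y - FY t x <= M * (y - x).
  move=> tab; apply: (@density_lipschitz R (FY t) (fY t) M (fY_meas t tab)) => //.
  - exact: fY_ge0.
  - move=> x; have := fY_le t x tab; rewrite fYsupE lee_fin.
    exact: le_trans (ler_norm _).
  - exact: FY_dens.
have mgen (F : Rd R d -> cumulativeBounded (0 : R) 1) (U : Rd R d -> Omega -> R) :
    (forall x, measurable_fun setT (fun t => F t x)) ->
    measurable_fun setT (fun p : Rd R d * Omega => U p.1 p.2) ->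
    measurable_fun setT (fun p : Rd R d * Omega => gen_inv (F p.1) (U p.1 p.2)).
  move=> mF mU; apply: (@measurable_gen_inv _ _ _ (F \o fst)) => // x.
  exact: (measurableT_comp (mF x)).
pose Z p := gen_inv (FY p.1) (UX p.1 p.2).
have mX : measurable_fun setT Xt by exact: mgen.
have mY : measurable_fun setT Yt by exact: mgen.
have mZ : measurable_fun setT Z by exact: mgen.
have mpow (f g : Rd R d * Omega -> R) : measurable_fun setT f ->
    measurable_fun setT g -> measurable_fun setT (fun p => (`|f p - g p| `^ q)%:E).
  move=> mf mg; apply/measurable_EFinP; apply: (measurableT_comp (measurable_powR q)).
  by apply: measurableT_comp => //; exact: measurable_funB.
have sec (U : Rd R d -> Omega -> R) t :
    measurable_fun setT (fun p : Rd R d * Omega => U p.1 p.2) ->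
    measurable_fun setT (U t).
  by move=> mU; exact: (measurableT_comp mU (pair1_measurable t)).
have U_le : (normU <= Lnorm (mu \x P)%E q%:E (fun p => (M * (Z p - Yt p))%:E))%E.
  apply: le_Lnorm_EFin => //; apply: (@le_integral_ae_section _ _ _ _ _ mu P
    _ _ _ mbox mu_supp).
  - exact: mpow.
  - apply/measurable_EFinP; apply: (measurableT_comp (measurable_powR q)).
    apply: measurableT_comp => //; apply: measurable_funM => //.
    exact: measurable_funB.
  - by move=> p; rewrite lee_fin powR_ge0.
  - by move=> p; rewrite lee_fin powR_ge0.
  move=> t tab.
  have uX := ae_uniform_oo (sec _ t UX_meas) (UX_unif t tab).
  have uY := ae_uniform_oo (sec _ t UY_meas) (UY_unif t tab).
  apply: filterS2 uX uY => w uX uY /=; rewrite lee_fin.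
  apply: ge0_ler_powR; rewrite ?nnegrE ?(ltW q0)//.
  rewrite normrM (ger0_norm M0) /Z /Yt /=.
  have lip := lipFY t tab.
  (* Each uniform value is rewritten as [FY t] at its own quantile, so the difference becomes an
     increment of [FY t] between [Z] and [Yt]. *)
  rewrite -{1}(gen_invK M0 lip uX) -{1}(gen_invK M0 lip uY).
  move: (gen_inv _ _) (gen_inv _ _) => x y.
  wlog xy : x y / x <= y => [H|].
    by have [/H|/ltW/H//] := leP x y; rewrite (distrC (FY t y)) (distrC y).
  rewrite !ger0_norm ?subr_ge0//.
    exact: lip.
  exact: cumulativeBounded_le.
have ZY_le : (Lnorm (mu \x P)%E q%:E (fun p => (Z p - Yt p)%:E) <=
    Lnorm (mu \x P)%E q%:E (fun p => (Z p - Xt p)%:E) + normXY)%E.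
  have := @minkowski_EFin _ _ _ (mu \x P)%E (fun p => Z p - Xt p)
    (fun p => Xt p - Yt p) q (measurable_funB mZ mX) (measurable_funB mX mY) q1.
  congr (_ <= _)%E; congr Lnorm; apply/funext => p /=.
  by rewrite addrA subrK.
have W0 t : (0 <= Wq_pow q (FX t) (FY t))%E.
  by apply: integral_ge0 => u _; rewrite lee_fin powR_ge0.
have WE : W = (\int[mu]_t Wq_pow q (FX t) (FY t))%E.
  by rewrite /W Lnorm1; apply: eq_integral => t _; rewrite gee0_abs.
have mW : measurable_fun setT (fun t => Wq_pow q (FX t) (FY t)).
  exact: measurable_Wq_pow.
(* The marginal hypotheses hold on the box only, whose complement is [mu]-null, so bounds in [t] are
   proved almost everywhere. *)
have aebox : {ae mu, forall t, cbox a b t}.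
  by exists (~` cbox a b); split => //; exact: measurableC.
have powE (f g : Rd R d * Omega -> R) :
    measurable_fun setT f -> measurable_fun setT g ->
    (Lnorm (mu \x P)%E q%:E (fun p => (f p - g p)%:E) =
     (\int[mu]_t \int[P]_w (`|f (t, w) - g (t, w)| `^ q)%:E) `^ q^-1)%E.
  move=> mf mg; rewrite Lnorm_EFin_powR.
  by rewrite (@fubini_tonelli1 _ _ _ _ _ mu P _ (mpow _ _ mf mg)).
have ige0 (f g : Rd R d * Omega -> R) t :
    (0 <= \int[P]_w (`|f (t, w) - g (t, w)| `^ q)%:E)%E.
  by apply: integral_ge0 => w _; rewrite lee_fin powR_ge0.
have mi (f g : Rd R d * Omega -> R) :
    measurable_fun setT f -> measurable_fun setT g ->
    measurable_fun setT
      (fun t => \int[P]_w (`|f (t, w) - g (t, w)| `^ q)%:E)%E.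
  move=> mf mg.
  apply: (@measurable_fun_fubini_tonelli_F _ _ _ _ _ P _ (mpow _ _ mf mg)).
  by move=> p; rewrite lee_fin powR_ge0.
have ZX_le : (Lnorm (mu \x P)%E q%:E (fun p => (Z p - Xt p)%:E) <= W `^ q^-1)%E.
  rewrite powE// WE; apply: le_poweR_inv => //; first exact: integral_ge0.
  apply: ae_ge0_le_integral => //; first exact: mi.
  apply: filterS aebox => t tab _.
  (* [Z] and [Xt] are driven by the same variable [UX t], so on the box the inner integral is
     exactly the Wasserstein term. *)
  rewrite (Wq_powE q (FX t) (FY t) (sec _ t UX_meas) (UX_unif t tab)).
  by under eq_integral do rewrite distrC.
have W_le : (W `^ q^-1 <= normXY)%E.
  rewrite /normXY powE// WE; apply: le_poweR_inv => //; first exact: integral_ge0.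
  apply: ae_ge0_le_integral => //; first exact: mi.
  apply: filterS aebox => t tab _.
  apply: (@Wq_pow_le_coupling _ _ _ _ P (FX t) (FY t) (UX t) (UY t)) => //.
  - exact: sec.
  - exact: sec.
  - exact: UX_unif.
  - exact: UY_unif.
have main : (normU <= fYsup * (normXY + W `^ q^-1))%E.
  apply: (le_trans U_le); rewrite Lnorm_EFin_Z//; last exact: measurable_funB.
  rewrite fYsupE; apply: lee_wpmul2l; first by rewrite lee_fin.
  by apply: (le_trans ZY_le); rewrite addeC leeD2l.
split=> //; apply: (le_trans main); rewrite [(2%:E * _)%E]muleC -muleA.
by apply: lee_wpmul2l => //; rewrite mule_natl mule2n; apply: leeD2l.
Qed.
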